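(* Let $G$ be a topological Abelian group. Suppose that there exists an open subgroup $A\leq G$ such that $A\in S_{TG}(\mathbb{T})$. Then $G\in S_{TG}(\mathbb{T})$.
   Context: $\mathbb{T}$ denotes the unit circle of $\mathbb{C}$ with its usual topology and multiplication. A twisted sum of topological Abelian groups is a short exact sequence $0\to Y\stackrel{\imath}{\to} X\stackrel{\pi}{\to} Z\to 0$ of topological Abelian groups and continuous homomorphisms in which $\imath$ and $\pi$ are open onto their images. It splits if there is a continuous homomorphism $\Phi:X\to Y\times Z$ such that $\Phi\circ\imath$ is the canonical inclusion $y\mapsto (y,0)$ and $\pi_Z\circ\Phi=\pi$, where $\pi_Z:Y\times Z\to Z$ is the projection (such $\Phi$ is necessarily a topological isomorphism). A topological Abelian group $G$ belongs to $S_{TG}(\mathbb{T})$ if every twisted sum of topological Abelian groups $0\to\mathbb{T}\to X\to G\to 0$ splits. Subgroups carry the induced topology. *)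

(* Defs.v *)
From HB Require Import structures.
From mathcomp Require Import all_boot all_order all_algebra.
From mathcomp Require Import complex.
From mathcomp Require Import all_classical all_reals all_analysis.

Set Implicit Arguments.
Unset Strict Implicit.
Unset Printing Implicit Defensive.

Import Order.TTheory GRing.Theory Num.Theory.
Import numFieldNormedType.Exports.

Local Open Scope classical_set_scope.
Local Open Scope ring_scope.
Local Open Scope complex_scope.

(* Topological Abelian groups are the library's [topologicalZmodType], so every
   group law is written additively; no separation axiom is assumed. *)

Section Circle.
Variable R : realType.

Record circle := Circle { circle_val : R[i]; circle_valP : `|circle_val| == 1 }.

HB.instance Definition _ := [isSub for circle_val].
HB.instance Definition _ := [Choice of circle by <:].

(* [R[i]^o] is [R[i]] as a module over itself; the library gives it the topology
   of the modulus. *)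
HB.instance Definition _ := Topological.copy circle
  (initial_topology (circle_val : circle -> R[i]^o)).

Lemma circle_one_subproof : `|1 : R[i]| == 1.
Proof. by rewrite normr1. Qed.

Lemma circle_mul_subproof (x y : circle) :
  `|circle_val x * circle_val y| == 1.
Proof. by rewrite normrM (eqP (circle_valP x)) (eqP (circle_valP y)) mulr1. Qed.

Lemma circle_inv_subproof (x : circle) : `|(circle_val x)^-1| == 1.
Proof. by rewrite normfV (eqP (circle_valP x)) invr1. Qed.

(* The additive notation on [circle] stands for complex multiplication. *)
Definition circle_zero : circle := Circle circle_one_subproof.
Definition circle_add (x y : circle) : circle := Circle (circle_mul_subproof x y).
Definition circle_opp (x : circle) : circle := Circle (circle_inv_subproof x).

Lemma circle_addA : associative circle_add.
Proof. by move=> x y z; apply: val_inj; rewrite /= mulrA. Qed.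

Lemma circle_addC : commutative circle_add.
Proof. by move=> x y; apply: val_inj; rewrite /= mulrC. Qed.

Lemma circle_add0 : left_id circle_zero circle_add.
Proof. by move=> x; apply: val_inj; rewrite /= mul1r. Qed.

Lemma circle_val_neq0 (x : circle) : circle_val x != 0.
Proof. by rewrite -normr_eq0 (eqP (circle_valP x)) oner_eq0. Qed.

Lemma circle_addN : left_inverse circle_zero circle_opp circle_add.
Proof. by move=> x; apply: val_inj; rewrite /= mulVf ?circle_val_neq0. Qed.

HB.instance Definition _ :=
  GRing.isZmodule.Build circle circle_addA circle_addC circle_add0 circle_addN.

Lemma circle_val_continuous : continuous (circle_val : circle -> R[i]^o).
Proof. exact: initial_continuous. Qed.

Lemma continuous_circle (T : topologicalType) (f : T -> circle) :
  continuous (circle_val \o f : T -> R[i]^o) -> continuous f.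
Proof.
move=> /continuousP cf; apply/continuousP => _ [B oB <-].
by rewrite -comp_preimage; exact: cf.
Qed.

Lemma circle_sub_continuous :
  continuous (fun x : circle * circle => x.1 - x.2).
Proof.
apply: continuous_circle => x.
apply: (@cvgM R[i] _ (nbhs x) _ (circle_val \o fst)
          ((fun z => z^-1) \o circle_val \o snd)).
  by apply: continuous_comp; [exact: cvg_fst|exact: circle_val_continuous].
apply: (@cvgV R[i]); first exact: circle_val_neq0.
by apply: continuous_comp; [exact: cvg_snd|exact: circle_val_continuous].
Qed.

HB.instance Definition _ :=
  PreTopologicalNmodule_isTopologicalZmodule.Build circle circle_sub_continuous.

End Circle.

Section Subgroup.
Variables (G : topologicalZmodType) (A : zmodClosed G).

Record subgroup := Subgroup { subgroup_val : G; _ : subgroup_val \in A }.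

HB.instance Definition _ := [isSub for subgroup_val].
HB.instance Definition _ := [Choice of subgroup by <:].
HB.instance Definition _ := [SubChoice_isSubZmodule of subgroup by <:].
HB.instance Definition _ :=
  Topological.copy subgroup (initial_topology subgroup_val).

Lemma subgroup_sub_continuous :
  continuous (fun x : subgroup * subgroup => x.1 - x.2).
Proof.
have cval : continuous subgroup_val by exact: initial_continuous.
apply/continuousP => _ [B oB <-].
suff /continuousP : continuous
    (fun x : subgroup * subgroup => subgroup_val x.1 - subgroup_val x.2).
  exact.
move=> x; apply: (@continuous_comp _ _ _
  (fun x : subgroup * subgroup => (subgroup_val x.1, subgroup_val x.2))
  (fun x : G * G => x.1 - x.2)); last exact: sub_continuous.
apply: cvg_pair; apply: continuous_comp; try exact: cval.
- exact: cvg_fst.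
- exact: cvg_snd.
Qed.

HB.instance Definition _ :=
  PreTopologicalNmodule_isTopologicalZmodule.Build subgroup
    subgroup_sub_continuous.

End Subgroup.

Definition open_onto_image (S T : topologicalType) (f : S -> T) : Prop :=
  forall U : set S, open U -> @open (subspace (range f)) (f @` U).

Record twisted_sum (Y X Z : topologicalZmodType)
    (i : {additive Y -> X}) (p : {additive X -> Z}) : Prop := TwistedSum {
  twisted_sum_inj : injective i;
  twisted_sum_exact : range i = [set x | p x = 0];
  twisted_sum_surj : range p = setT;
  twisted_sum_continuous_inj : continuous i;
  twisted_sum_continuous_proj : continuous p;
  twisted_sum_open_inj : open_onto_image i;
  twisted_sum_open_proj : open_onto_image p
}.

Definition splits (Y X Z : topologicalZmodType)
    (i : {additive Y -> X}) (p : {additive X -> Z}) : Prop :=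
  exists Phi : {additive X -> (Y * Z)%type},
    [/\ continuous Phi,
        forall y, Phi (i y) = (y, 0)
      & forall x, (Phi x).2 = p x].

Definition S_TG (Y Z : topologicalZmodType) : Prop :=
  forall (X : topologicalZmodType)
    (i : {additive Y -> X}) (p : {additive X -> Z}),
    twisted_sum i p -> splits i p.

(* Main.v *)
Require Import Defs.
From HB Require Import structures.
From mathcomp Require Import all_boot all_order all_algebra.
From mathcomp Require Import complex.
From mathcomp Require Import all_classical all_reals all_analysis.

Set Implicit Arguments.
Unset Strict Implicit.
Unset Printing Implicit Defensive.

Import Order.TTheory GRing.Theory Num.Theory.

Local Open Scope classical_set_scope.
Local Open Scope ring_scope.

(** The circle is a divisible group, hence injective among abstract abelian
    groups: a homomorphism into it extends from any subgroup (Baer's criterion,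
    [divisible_injective]). This is all that is needed about the circle.

    Let Y be divisible, let A be an open subgroup of G with S_TG Y A, and let
    0 -> Y -> X -> G -> 0 be a twisted sum with maps [i] and [p]. A splitting of
    it is the same as a continuous retraction of [i], that is, a continuous
    homomorphism r : X -> Y with r \o i = id ([retraction_splits]). Restrict the
    sequence to H := p^-1(A), an open subgroup of X that contains i(Y). The
    restriction 0 -> Y -> H -> A -> 0 is again a twisted sum
    ([restrict_twisted_sum]), so it splits and yields a continuous retraction
    H -> Y. By injectivity this retraction extends to an abstract homomorphism
    r : X -> Y. The extension is automatically continuous: it is continuous on
    H, a neighbourhood of 0, and a homomorphism continuous at 0 is continuous
    everywhere ([continuous_additive_open_subgroup]). It retracts [i] because
    i(Y) lies in H. *)

(** * Divisible abelian groups are injective *)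

Definition divisible (D : zmodType) : Prop :=
  forall (d : D) (n : nat), (0 < n)%N -> exists e : D, e *+ n = d.

(** The graph of a homomorphism from some subgroup of M to D. The domain is not
    part of the data, so that extending a homomorphism is mere inclusion of
    graphs and a union of a chain needs no gluing. The empty set is allowed. *)
Definition partial_hom (M D : zmodType) (F : set (M * D)) : Prop :=
  (forall m n c d, F (m, c) -> F (n, d) -> F (m - n, c - d)) /\
  (forall d, F (0, d) -> d = 0).

Section PartialHom.
Variables (M D : zmodType) (F : set (M * D)).
Hypothesis homF : partial_hom F.

Lemma partial_hom0 m c : F (m, c) -> F (0, 0).
Proof. by move=> Fmc; rewrite -(subrr m) -(subrr c); exact: homF.1. Qed.

Lemma partial_homMz m c (k : int) : F (m, c) -> F (m *~ k, c *~ k).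
Proof.
move=> Fmc; have F0 := partial_hom0 Fmc.
have FN a b : F (a, b) -> F (- a, - b).
  by move=> Fab; have := homF.1 _ _ _ _ F0 Fab; rewrite !sub0r.
have FMn n : F (m *+ n, c *+ n).
  elim: n => [|n IHn]; first by rewrite !mulr0n.
  have := homF.1 _ _ _ _ IHn (FN _ _ Fmc).
  by rewrite !opprK -!mulrSr.
by case: k => n; [|rewrite NegzE !mulrNz; apply: FN]; exact: FMn.
Qed.

Lemma partial_hom_inj m c c' : F (m, c) -> F (m, c') -> c = c'.
Proof.
move=> Fc Fc'; apply/eqP; rewrite -subr_eq0; apply/eqP/homF.2.
by rewrite -(subrr m); exact: homF.1.
Qed.

(** The integers k such that the domain of F contains kx form an ideal nZ, so
    that on the multiples of x the homomorphism F is determined by its value d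
    at nx. An e with ne = d then serves as a value at x; when n = 0 any e
    would do. *)
Lemma divisible_multiples_value (x : M) : divisible D ->
  exists e : D, forall (k : int) (c : D), F (x *~ k, c) -> c = e *~ k.
Proof.
move=> divD.
pose P (n : nat) := `[< (0 < n)%N /\ exists c, F (x *+ n, c) >].
have [exP|noP] := pselect (exists n, P n); last first.
  exists 0 => k c Fkc; rewrite mul0rz.
  have P_contra n c' : (0 < n)%N -> ~ F (x *+ n, c').
    by move=> n_gt0 Fn; apply: noP; exists n; apply/asboolP; split; [|exists c'].
  case: k Fkc => [[|n]|n] Fkc.
  - exact: homF.2 Fkc.
  - by have := P_contra n.+1 c isT Fkc.
  - have := partial_homMz (-1) Fkc.
    rewrite NegzE mulrNz !mulrN1z opprK => Fn.
    by case: (P_contra n.+1 (- c) isT Fn).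
case: (ex_minnP exP) => n /asboolP[n_gt0 [d Fd]] min_n.
have [e en] := divD d n n_gt0; exists e => k c Fk.
have n_neq0 : n%:Z != 0 by rewrite -lt0n.
pose q := (k %/ n%:Z)%Z; pose r := (k %% n%:Z)%Z.
have kE : k = n%:Z * q + r by rewrite mulrC; exact: divz_eq.
have Fnq : F (x *~ (n%:Z * q), d *~ q).
  by rewrite mulrzA; exact: partial_homMz.
have Fr : F (x *~ r, c - d *~ q).
  have := homF.1 _ _ _ _ Fk Fnq; congr (F (_, _)).
  by rewrite /= -mulrzBr {1}kE addrC addKr.
have r0 : r = 0.
  have r_ge0 : 0 <= r by exact: modz_ge0.
  have r_ltn : r < n%:Z by exact: ltz_pmod.
  case: r r_ge0 r_ltn Fr {kE} => // [[//|m]] _ m_ltn Fr.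
  have /min_n : P m.+1 by apply/asboolP; split => //; eexists; exact: Fr.
  by rewrite leqNgt -ltz_nat m_ltn.
have {r0}kE : k = n%:Z * q by rewrite kE r0 addr0.
rewrite -kE in Fnq.
by rewrite (partial_hom_inj Fk Fnq) [in RHS]kE mulrzA -pmulrn en.
Qed.

End PartialHom.

(** The extension sends m + kx to c + ke for (m, c) in F. The assumption on e is
    exactly what makes this independent of the way of writing m + kx. *)
Lemma partial_hom_adjoin (M D : zmodType) (F : set (M * D)) (x : M) (e : D) :
  partial_hom F ->
  (forall (k : int) (c : D), F (x *~ k, c) -> c = e *~ k) ->
  partial_hom [set z | exists k : int, F (z.1 - x *~ k, z.2 - e *~ k)].
Proof.
move=> homF valF; split=> [m n c d [k /= Fm] [l /= Fn]|d [k /= Fd]].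
  have subACA (V : zmodType) (a b u v : V) : a - b - (u - v) = a - u - (b - v).
    by rewrite !opprB addrACA [RHS]addrACA [- b - u]addrC.
  exists (k - l) => /=; rewrite !mulrzBr [m - _ - _]subACA [c - _ - _]subACA.
  exact: homF.1.
have := partial_homMz homF (-1) Fd.
rewrite !mulrN1z !opprB subr0 => /valF/eqP.
by rewrite -subr_eq0 addrAC subrr sub0r oppr_eq0 => /eqP.
Qed.

Lemma total_partial_hom (M D : zmodType) (F : set (M * D)) :
  partial_hom F -> (forall x, exists d, F (x, d)) ->
  exists g : {additive M -> D}, forall x d, F (x, d) -> g x = d.
Proof.
move=> homF /choice[g Fg].
have gB : zmod_morphism g.
  move=> x y; apply: (partial_hom_inj homF (Fg (x - y))).
  exact: homF.1.
pose gM := GRing.isZmodMorphism.Build M D g gB.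
pose gA : {additive M -> D} := HB.pack g gM.
by exists gA => x d Fxd; exact: (partial_hom_inj homF (Fg x) Fxd).
Qed.

(** Baer's criterion over the integers: by Zorn's lemma there is a maximal
    partial homomorphism extending f, and it is total because a divisible target
    always leaves room to adjoin one more element to the domain. *)
Lemma divisible_injective (N M D : zmodType)
    (j : {additive N -> M}) (f : {additive N -> D}) :
  divisible D -> injective j ->
  exists g : {additive M -> D}, forall n, g (j n) = f n.
Proof.
move=> divD j_inj.
pose F0 : set (M * D) := range (fun n => (j n, f n)).
(* Nonemptiness guards the inclusion so that the empty chain, whose union is
   empty, has an upper bound satisfying P. *)
pose P : set (set (M * D)) :=
  [set F | partial_hom F /\ (F !=set0 -> F0 `<=` F)].
have F0hom : partial_hom F0.
  split=> [_ _ _ _ [m _ [<- <-]] [n _ [<- <-]]|d [n _ [jn <-]]].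
    by exists (m - n); rewrite ?raddfB.
  have -> : n = 0 by apply: j_inj; rewrite jn raddf0.
  by rewrite raddf0.
have [C CP Ctot|F [[homF F0F] maxF]] := @Zorn_bigcup _ P.
  split; last first.
    move=> [z [A CA Az]] y F0y; exists A => //.
    by have [_ F0A] := CP _ CA; apply: F0A => //; exists z.
  split=> [m n c d [A CA Am] [B CB Bn]|d [A CA Ad]]; last first.
    by have [[_ +] _] := CP _ CA; exact.
  have [AB|BA] := Ctot _ _ CA CB.
    by exists B => //; have [[+ _] _] := CP _ CB; apply=> //; exact: AB.
  by exists A => //; have [[+ _] _] := CP _ CA; apply=> //; exact: BA.
(* The maximal F is not empty, since F0 is strictly larger than the empty set. *)
have {}F0F : F0 `<=` F.
  have [//|Fempty] := pselect (F !=set0).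
  case: (maxF F0); last by split=> // _ z.
  split=> [z Fz|F0F']; first by case: Fempty; exists z.
  by case: Fempty; exists (j 0, f 0); apply: F0F'; exists 0.
have F00 : F (0, 0) by apply: F0F; exists 0; rewrite ?raddf0.
have [x|g gF] := total_partial_hom homF; last first.
  by exists g => n; apply: gF; apply: F0F; exists n.
have [e valF] := divisible_multiples_value homF x divD.
pose F' : set (M * D) :=
  [set z | exists k : int, F (z.1 - x *~ k, z.2 - e *~ k)].
have FF' : F `<=` F' by move=> [m c] Fz; exists 0; rewrite !mulr0z !subr0.
exists e; apply: contrapT => NFx.
case: (maxF F').
  split=> // F'F; apply/NFx/F'F.
  by exists 1; rewrite /= !mulr1z !subrr.
split; first exact: partial_hom_adjoin.
by move=> _; exact: subset_trans FF'.
Qed.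

Lemma circle_val_mulrn (R : realType) (x : circle R) (n : nat) :
  circle_val (x *+ n) = circle_val x ^+ n.
Proof. by elim: n => // n IHn; rewrite mulrS exprS -IHn. Qed.

(** Complex numbers have n-th roots, and an n-th root of a number of modulus 1
    has modulus 1. *)
Lemma circle_divisible (R : realType) : divisible (circle R).
Proof.
move=> d n n_gt0; pose w : R[i] := n.-root (circle_val d).
have wn : w ^+ n = circle_val d by exact: rootCK.
have w1 : `|w| == 1.
  by rewrite -(pexpr_eq1 n_gt0) // -normrX wn; exact: circle_valP.
by exists (Circle w1); apply: val_inj; rewrite [LHS]circle_val_mulrn.
Qed.

(** * Continuity of homomorphisms *)

Lemma continuous_additive_at0 (X Y : topologicalZmodType)
    (r : {additive X -> Y}) :
  {for 0, continuous r} -> continuous r.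
Proof.
move=> r0 x.
have -> : r = (fun z => r (z - x) + r x) :> (X -> Y).
  by apply/funext => z; rewrite raddfB subrK.
apply: (@continuous_comp _ _ _ (fun z => (r (z - x), r x))
  (fun u : Y * Y => u.1 + u.2)); last exact: add_continuous.
apply: cvg_pair; last exact: cvg_cst.
apply: (@continuous_comp _ _ _ (fun z => z - x) r).
  apply: (@continuous_comp _ _ _ (fun z => (z, x))
    (fun u : X * X => u.1 - u.2)); last exact: sub_continuous.
  by apply: cvg_pair; [exact: cvg_id|exact: cvg_cst].
by rewrite subrr.
Qed.

(** Neighbourhoods of 0 in an open subgroup are neighbourhoods of 0 in the whole
    group, so continuity on the subgroup gives continuity at 0. *)
Lemma continuous_additive_open_subgroup (X Y : topologicalZmodType)
    (H : zmodClosed X) (r : {additive X -> Y}) :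
  open [set x : X | x \in H] ->
  continuous (r \o (\val : subgroup H -> X)) -> continuous r.
Proof.
move=> openH /continuousP cr; apply: continuous_additive_at0.
move=> W; rewrite /continuous_at raddf0 nbhsE => -[V [openV V0] VW].
have [U openU UE] := cr _ openV.
have HV x (xH : x \in H) : U x <-> V (r x).
  by have := congr1 (fun S : set _ => S (Subgroup xH)) UE; rewrite /= => ->.
rewrite nbhs_simpl /= nbhsE; exists (U `&` [set x | x \in H]).
  split; first exact: openI.
  by split; [apply/(HV _ (rpred0 H)); rewrite raddf0|exact: rpred0].
by move=> x [Ux xH]; apply/VW/(HV _ xH).
Qed.

(** * Twisted sums and their restrictions *)

Lemma retraction_splits (Y X Z : topologicalZmodType)
    (i : {additive Y -> X}) (p : {additive X -> Z}) (r : {additive X -> Y}) :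
  (forall y, p (i y) = 0) -> continuous p -> continuous r ->
  (forall y, r (i y) = y) -> splits i p.
Proof.
move=> pi0 cp cr ri.
have PhiB : zmod_morphism (fun x => (r x, p x)).
  by move=> x y; rewrite !raddfB.
pose PhiMorph := GRing.isZmodMorphism.Build X (Y * Z)%type _ PhiB.
pose Phi : {additive X -> (Y * Z)%type} :=
  HB.pack (fun x => (r x, p x)) PhiMorph.
exists Phi; split=> // [x|y].
  by apply: cvg_pair; [exact: cr|exact: cp].
by rewrite /= ri pi0.
Qed.

Section RestrictTwistedSum.
Variables (Y X G : topologicalZmodType) (A : zmodClosed G).
Variables (i : {additive Y -> X}) (p : {additive X -> G}).

Definition over_subgroup : {pred X} := [pred x | p x \in A].

Lemma over_subgroup_zmod_closed : zmod_closed over_subgroup.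
Proof.
by split=> [|x y]; rewrite !inE ?raddf0 ?raddfB ?rpred0//; exact: rpredB.
Qed.

HB.instance Definition _ :=
  GRing.isZmodClosed.Build X over_subgroup over_subgroup_zmod_closed.

Definition restrict_proj (x : subgroup over_subgroup) : subgroup A :=
  Subgroup (valP x : p (\val x) \in A).

Lemma restrict_proj_zmod_morphism : zmod_morphism restrict_proj.
Proof. by move=> x y; apply: val_inj; rewrite /= !raddfB. Qed.

HB.instance Definition _ :=
  GRing.isZmodMorphism.Build _ _ restrict_proj restrict_proj_zmod_morphism.

Hypothesis ip : twisted_sum i p.

Lemma twisted_sum_proj_inj y : p (i y) = 0.
Proof.
have : range i (i y) by exists y.
by rewrite (twisted_sum_exact ip).
Qed.

Lemma twisted_sum_inj_over y : i y \in over_subgroup.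
Proof. by rewrite inE twisted_sum_proj_inj rpred0. Qed.

Definition restrict_inj (y : Y) : subgroup over_subgroup :=
  Subgroup (twisted_sum_inj_over y).

Lemma restrict_inj_zmod_morphism : zmod_morphism restrict_inj.
Proof. by move=> x y; apply: val_inj; rewrite /= !raddfB. Qed.

HB.instance Definition _ :=
  GRing.isZmodMorphism.Build _ _ restrict_inj restrict_inj_zmod_morphism.

(** Exactness and relative openness pass to the restriction because H = p^-1(A)
    is saturated: it contains the whole fibre of p over each point of A, in
    particular the kernel i(Y). *)
Lemma restrict_twisted_sum : twisted_sum restrict_inj restrict_proj.
Proof.
split.
- by move=> y y' [] /(twisted_sum_inj ip).
- apply/seteqP; split=> [_ [y _ <-]|x /= /(congr1 \val)/= px0].
    by apply: val_inj; exact: twisted_sum_proj_inj.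
  have : range i (\val x) by rewrite (twisted_sum_exact ip).
  by move=> [y _ iy]; exists y => //; exact: val_inj.
- apply/seteqP; split=> // a _.
  have [x _ px] : range p (\val a) by rewrite (twisted_sum_surj ip).
  have xH : x \in over_subgroup by rewrite inE px; exact: valP.
  by exists (Subgroup xH) => //; apply: val_inj.
- apply: continuous_comp_initial; exact: twisted_sum_continuous_inj ip.
- apply: continuous_comp_initial => x.
  apply: (@continuous_comp _ _ _ (\val : subgroup over_subgroup -> X) p).
    exact: initial_continuous.
  exact: (twisted_sum_continuous_proj ip).
- move=> U /(twisted_sum_open_inj ip)/open_subspaceP[V openV VU].
  apply/open_subspaceP; exists (\val @^-1` V); first by exists V.
  apply/seteqP; split=> [_ [/[swap] [[y _ <-]] Vx]|_ [[y Uy <-] _]].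
    split; last by exists y.
    have : (V `&` range i) (i y) by split; [exact: Vx|exists y].
    rewrite VU => -[[z Uz iz] _].
    by exists z => //; apply: val_inj.
  split; last by exists y.
  have : (i @` U `&` range i) (i y) by split; exists y.
  by rewrite -VU => -[].
- move=> _ [V openV <-].
  have := twisted_sum_open_proj ip openV.
  move=> /open_subspaceP[W openW].
  rewrite (twisted_sum_surj ip) !setIT => WE.
  apply/open_subspaceP; exists (\val @^-1` W); first by exists W.
  (* The open W is p(V), and saturation gives restrict_proj(V & H) = p(V) & A. *)
  congr (_ `&` _); rewrite WE; apply/seteqP; split=> [a [x Vx px]|_ [x Vx <-]].
    have xH : x \in over_subgroup by rewrite inE px; exact: valP.
    by exists (Subgroup xH) => //; apply: val_inj.
  by exists (\val x).
Qed.

End RestrictTwistedSum.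

(** * Passing from an open subgroup to the whole group *)

(** Divisibility extends the retraction obtained on p^-1(A) to all of X, and
    openness of A makes the extension continuous. *)
Lemma S_TG_open_subgroup (Y G : topologicalZmodType) (A : zmodClosed G) :
  divisible Y -> open [set x : G | x \in A] ->
  S_TG Y (subgroup A) -> S_TG Y G.
Proof.
move=> divY openA splitA X i p ip.
have [Phi [cPhi Phii _]] := splitA _ _ _ (restrict_twisted_sum A ip).
have PhiB : zmod_morphism (fun x => (Phi x).1).
  by move=> x y; rewrite raddfB.
pose PhiMorph := GRing.isZmodMorphism.Build _ _ _ PhiB.
pose r0 : {additive _ -> _} := HB.pack (fun x => (Phi x).1) PhiMorph.
have [r rE] := @divisible_injective _ X Y \val r0 divY val_inj.
apply: (@retraction_splits _ _ _ i p r).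
- exact: twisted_sum_proj_inj ip.
- exact: twisted_sum_continuous_proj ip.
- apply: (@continuous_additive_open_subgroup _ _ (over_subgroup A p)).
    by have /continuousP/(_ _ openA) := twisted_sum_continuous_proj ip.
  have -> : r \o \val = fst \o Phi by apply/funext.
  by move=> x; apply: continuous_comp; [exact: cPhi|exact: cvg_fst].
- by move=> y; rewrite -[i y]/(\val (restrict_inj A ip y)) rE /= Phii.
Qed.

Theorem corollary2p10 (R : realType) (G : topologicalZmodType) :
  (exists A : zmodClosed G,
     open [set x : G | x \in A] /\ S_TG (circle R) (subgroup A)) ->
  S_TG (circle R) G.
Proof.
move=> [A [openA splitA]].
exact: S_TG_open_subgroup (@circle_divisible R) openA splitA.
Qed.
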